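(* Let $A$ and $B$ be asynchronously composable IOTSes. (1) If $A$ and $B$ are strongly asynchronously compatible, then $A$ and $B$ are strongly synchronously compatible. (2) If at least one of the following conditions holds: (a) $A\otimes_{as}B$ satisfies property $\mathcal{P}$; (b) $A\otimes_{as}B$ is half-duplex; (c) for each $(s_A,s_B)\in\mathit{reach}(A\otimes B)$ and all transitions $s_A\xrightarrow{a}_A s_A'$, $s_B\xrightarrow{b}_B s_B'$, either $a\notin\mathit{out}_A\cap\mathit{in}_B$ or $b\notin\mathit{out}_B\cap\mathit{in}_A$ — then, if $A$ and $B$ are weakly asynchronously compatible, they are weakly synchronously compatible.
   Context: An IOTS $A=(\mathit{states}_A,\mathit{start}_A,\mathit{act}_A,\to_A)$ has states, initial state, actions $\mathit{act}_A=\mathit{in}_A\cup\mathit{out}_A\cup\mathit{int}_A$ (disjoint union of inputs, outputs, internal actions) and transitions $s\xrightarrow{a}_A s'$. $s\ (\xrightarrow{X})^*_A\ s'$ denotes a possibly empty finite sequence of transitions labelled in $X$; $\mathit{reach}(A)$ is the set of states reachable from $\mathit{start}_A$. $A,B$ are composable if $\mathit{act}_A\cap\mathit{act}_B=(\mathit{in}_A\cap\mathit{out}_B)\cup(\mathit{in}_B\cap\mathit{out}_A)=:\mathit{shared}(A,B)$. Synchronous composition $A\otimes B$: states $\mathit{states}_A\times\mathit{states}_B$, initial $(\mathit{start}_A,\mathit{start}_B)$, inputs $(\mathit{in}_A\cup\mathit{in}_B)\setminus\mathit{shared}(A,B)$, outputs $(\mathit{out}_A\cup\mathit{out}_B)\setminus\mathit{shared}(A,B)$,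 internal $\mathit{int}_A\cup\mathit{int}_B\cup\mathit{shared}(A,B)$; a non-shared action of one component moves only that component; a shared action $a$ yields $(s,t)\xrightarrow{a}(s',t')$ when $s\xrightarrow{a}_A s'$ and $t\xrightarrow{a}_B t'$. For a set $M$, $M^\rhd=\{a^\rhd\mid a\in M\}$ are fresh names. $A,B$ are asynchronously composable if composable and $\mathit{shared}(A,B)^\rhd\cap(\mathit{act}_A\cup\mathit{act}_B)=\emptyset$. With $\mathit{out}_{AB}=\mathit{out}_A\cap\mathit{in}_B$, $\Omega(A)$ is the IOTS with states $(s,q)$, $s\in\mathit{states}_A$, $q\in\mathit{out}_{AB}^*$, initial $(\mathit{start}_A,\epsilon)$, inputs $\mathit{in}_A$, outputs $\mathit{out}_A$, internal actions $\mathit{int}_A\cup\mathit{out}_{AB}^\rhd$, transitions $(s,q)\xrightarrow{a}(s',q)$ if $s\xrightarrow{a}_A s'$, $a\notin\mathit{out}_{AB}$; $(s,q)\xrightarrow{a^\rhd}(s',qa)$ if $s\xrightarrow{a}_A s'$, $a\in\mathit{out}_{AB}$; $(s,aq)\xrightarrow{a}(s,q)$ for $a\in\mathit{out}_{AB}$. $\Omega(B)$ analogously with $\mathit{out}_{BA}=\mathit{out}_B\cap\mathit{in}_A$. $A\otimes_{as}B=\Omega(A)\otimes\Omega(B)$, with states $((s_A,q_A),(s_B,q_B))$ and initial state $((\mathit{start}_A,\epsilon),(\mathit{start}_B,\epsilon))$. $A,B$ are strongly synchronously compatible if composable and for all $(s_A,s_B)\in\mathit{reach}(A\otimes B)$ and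 $a\in\mathit{out}_A\cap\mathit{in}_B$: if $s_A\xrightarrow{a}_A s_A'$ for some $s_A'$ then $s_B\xrightarrow{a}_B s_B'$ for some $s_B'$; and symmetrically for $b\in\mathit{out}_B\cap\mathit{in}_A$. Weakly synchronously compatible: same but with the conclusion $s_B\ (\xrightarrow{\mathit{int}_B})^*_B\ \bar s_B\xrightarrow{a}_B s_B'$ for some $\bar s_B,s_B'$ (symmetrically with $\mathit{int}_A$). Asynchronously composable $A,B$ are strongly (weakly) asynchronously compatible if $\Omega(A)$ and $\Omega(B)$ are strongly (weakly) synchronously compatible. $A\otimes_{as}B$ is half-duplex if each reachable state $((s_A,q_A),(s_B,q_B))$ of $\Omega(A)\otimes\Omega(B)$ has $q_A=\epsilon$ or $q_B=\epsilon$. Property $\mathcal{P}$: with $F_A=\mathit{act}_A\setminus\mathit{shared}(A,B)$, for $a\in\mathit{out}_A\cap\mathit{in}_B$ write $s\Rightarrow^a_A s'$ if $s\ (\xrightarrow{F_A})^*_A\ \bar s\xrightarrow{a}_A\bar s'\ (\xrightarrow{F_A})^*_A\ s'$ for some $\bar s,\bar s'$; $\Rightarrow^b_B$ analogously with $F_B=\mathit{act}_B\setminus\mathit{shared}(A,B)$. $A\otimes_{as}B$ satisfies $\mathcal{P}$ if every reachable state $((s_A,q_A),(s_B,q_B))$ satisfies one of: (i) $q_A=q_B=\epsilon$ and $(s_A,s_B)\in\mathit{reach}(A\otimes B)$; (ii) $q_A=a_1\ldots a_m\neq\epsilon$, $q_B=\epsilon$, and some $r_A$ has $(r_A,s_B)\in\mathit{reach}(A\otimes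 B)$ and $r_A\Rightarrow^{a_1}_A\cdots\Rightarrow^{a_m}_A s_A$; (iii) $q_A=\epsilon$, $q_B=b_1\ldots b_m\neq\epsilon$, and some $r_B$ has $(s_A,r_B)\in\mathit{reach}(A\otimes B)$ and $r_B\Rightarrow^{b_1}_B\cdots\Rightarrow^{b_m}_B s_B$. *)

(* Defs.v *)
From mathcomp Require Import all_boot.
From mathcomp Require Import boolp classical_sets.
From Stdlib Require Import Relation_Operators.

Set Implicit Arguments.
Unset Strict Implicit.
Unset Printing Implicit Defensive.

Local Open Scope classical_set_scope.

(* All IOTSes draw their actions from one universe of names, so that the
   actions of different IOTSes can be compared; [rhd a] is the name written
   a^|>. That the names M^|> do not clash with the actions in use is not built
   in here: it is the second half of [async_composable]. *)
Record names := Names {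
  name :> Type;
  rhd : name -> name;
  rhd_inj : injective rhd }.

Record iots (N : names) := IOTS {
  states : Type;
  start : states;
  inp : set N;
  out : set N;
  int : set N;
  trans : states -> N -> states -> Prop;
  inp_out0 : inp `&` out = set0;
  inp_int0 : inp `&` int = set0;
  out_int0 : out `&` int = set0;
  trans_act : forall s a s', trans s a s' -> (inp `|` out `|` int) a }.

Section Iots.
Context {N : names}.
Implicit Types A B : iots N.

Definition act A : set N := inp A `|` out A `|` int A.

Definition steps A (X : set N) : states A -> states A -> Prop :=
  clos_refl_trans_1n (states A) (fun s s' => exists2 a, X a & trans s a s').

Definition reach A : set (states A) := [set s | steps (act A) (start A) s].

Arguments reach A : clear implicits.

Definition shared A B : set N := (inp A `&` out B) `|` (inp B `&` out A).

Definition composable A B : Prop := act A `&` act B = shared A B.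

Inductive sync_trans A B :
    states A * states B -> N -> states A * states B -> Prop :=
| sync_left s a s' t :
    ~ shared A B a -> trans s a s' -> sync_trans (s, t) a (s', t)
| sync_right s t a t' :
    ~ shared A B a -> trans t a t' -> sync_trans (s, t) a (s, t')
| sync_shared s t a s' t' :
    shared A B a -> trans s a s' -> trans t a t' ->
    sync_trans (s, t) a (s', t').

Section Sync.
Context {A B : iots N}.
Hypothesis cAB : composable A B.

Let sh := shared A B.
Let sync_inp := (inp A `|` inp B) `\` sh.
Let sync_out := (out A `|` out B) `\` sh.
Let sync_int := int A `|` int B `|` sh.

Lemma both_shared a : act A a -> act B a -> sh a.
Proof. by move=> aA aB; rewrite /sh -cAB. Qed.

Lemma sync_inp_out0 : sync_inp `&` sync_out = set0.
Proof.
apply/seteqP; split => // a [[[i|i] ns] [[o|o] _]].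
- by rewrite -(inp_out0 A).
- by apply: ns; left.
- by apply: ns; right.
- by rewrite -(inp_out0 B).
Qed.

Lemma sync_inp_int0 : sync_inp `&` sync_int = set0.
Proof.
apply/seteqP; split => // a [[[i|i] ns] [[k|k]|//]].
- by rewrite -(inp_int0 A).
- by apply: ns; apply: both_shared; [left; left|right].
- by apply: ns; apply: both_shared; [right|left; left].
- by rewrite -(inp_int0 B).
Qed.

Lemma sync_out_int0 : sync_out `&` sync_int = set0.
Proof.
apply/seteqP; split => // a [[[o|o] ns] [[k|k]|//]].
- by rewrite -(out_int0 A).
- by apply: ns; apply: both_shared; [left; right|right].
- by apply: ns; apply: both_shared; [right|left; right].
- by rewrite -(out_int0 B).
Qed.

Lemma sync_trans_act p a p' :
  @sync_trans A B p a p' -> (sync_inp `|` sync_out `|` sync_int) a.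
Proof.
case=> [s {}a s' t ns /trans_act|s t {}a t' ns /trans_act|s t {}a s' t' sa _ _].
- by move=> [[i|o]|k]; [left; left|left; right|right; left; left]; try split;
    rewrite // /setU /=; left.
- by move=> [[i|o]|k]; [left; left|left; right|right; left; right]; try split;
    rewrite // /setU /=; right.
- by right; right.
Qed.

Definition sync_comp : iots N :=
  @IOTS N (states A * states B) (start A, start B)
    ((inp A `|` inp B) `\` shared A B)
    ((out A `|` out B) `\` shared A B)
    (int A `|` int B `|` shared A B)
    (@sync_trans A B)
    sync_inp_out0 sync_inp_int0 sync_out_int0 sync_trans_act.

End Sync.

Definition async_composable A B : Prop :=
  composable A B /\ (@rhd N @` shared A B) `&` (act A `|` act B) = set0.

Definition out_to A B : set N := out A `&` inp B.

(* [out_to A B] is used as a type below, so that [seq (out_to A B)] is the set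
   of words over this alphabet; [val] forgets membership in it. *)
Inductive omega_trans A B :
    states A * seq (out_to A B) -> N -> states A * seq (out_to A B) -> Prop :=
| omega_keep s q a s' :
    ~ out_to A B a -> trans s a s' -> omega_trans (s, q) a (s', q)
| omega_enqueue s q (a : out_to A B) s' :
    trans s (val a) s' ->
    omega_trans (s, q) (rhd (val a)) (s', rcons q a)
| omega_dequeue s (a : out_to A B) q :
    omega_trans (s, a :: q) (val a) (s, q).

Lemma shared_sym A B : shared A B = shared B A.
Proof. by rewrite /shared setUC. Qed.

Lemma composable_sym A B : composable A B -> composable B A.
Proof. by rewrite /composable setIC (shared_sym B A). Qed.

Lemma async_composable_sym A B : async_composable A B -> async_composable B A.
Proof.
by case=> c r; split; [exact: composable_sym|rewrite shared_sym setUC].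
Qed.

Section Omega.
Context {A B : iots N}.
Hypothesis cAB : async_composable A B.

Let om_int := int A `|` (@rhd N @` out_to A B).

Lemma rhd_out_to_fresh a : out_to A B a -> ~ (act A `|` act B) (rhd a).
Proof.
case=> o i aAB; suff: set0 (rhd a) by [].
by rewrite -(proj2 cAB); split=> //; exists a => //; right.
Qed.

Lemma omega_inp_int0 : inp A `&` om_int = set0.
Proof.
apply/seteqP; split => // a [i [k|[b bo e]]]; first by rewrite -(inp_int0 A).
by case: (rhd_out_to_fresh bo); rewrite e; do 3 left.
Qed.

Lemma omega_out_int0 : out A `&` om_int = set0.
Proof.
apply/seteqP; split => // a [o [k|[b bo e]]]; first by rewrite -(out_int0 A).
by case: (rhd_out_to_fresh bo); rewrite e; left; left; right.
Qed.

Lemma omega_trans_act p a p' :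
  @omega_trans A B p a p' -> (inp A `|` out A `|` om_int) a.
Proof.
case=> [s q {}a s' _ /trans_act|s q {}a s' _|s {}a q].
- by move=> [aio|k]; [left|right; left].
- by right; right; exists (val a) => //; apply: set_mem; exact: valP.
- by left; right; have /set_mem[] := valP a.
Qed.

Definition omega : iots N :=
  @IOTS N (states A * seq (out_to A B)) (start A, [::])
    (inp A) (out A) (int A `|` (@rhd N @` out_to A B))
    (@omega_trans A B)
    (inp_out0 A) omega_inp_int0 omega_out_int0 omega_trans_act.

End Omega.

Lemma omega_composable A B (cAB : async_composable A B) :
  composable (omega cAB) (omega (async_composable_sym cAB)).
Proof.
have cBA := async_composable_sym cAB.
apply/seteqP; split=> a; last first.
  by case=> -[x y]; split; left; [left|right|right|left].
case=> /= aA aB.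
have {}aA : act A a \/ (@rhd N @` out_to A B) a.
  by case: aA => [?|[?|?]]; [left; left|left; right|right].
have {}aB : act B a \/ (@rhd N @` out_to B A) a.
  by case: aB => [?|[?|?]]; [left; left|left; right|right].
case: aA aB => [aA|[b bo e]] [aB|[b' bo' e']].
- by have : (act A `&` act B) a by []; rewrite (proj1 cAB).
- by case: (rhd_out_to_fresh cBA bo'); rewrite e'; right.
- by case: (rhd_out_to_fresh cAB bo); rewrite e; right.
- have bb : b = b' by apply: (@rhd_inj N); rewrite e e'.
  suff: set0 b by [].
  by rewrite -(inp_out0 A); split; [rewrite bb; case: bo'|case: bo].
Qed.

Definition async_comp A B (cAB : async_composable A B) : iots N :=
  sync_comp (omega_composable cAB).

Definition strongly_sync_compatible A B : Prop :=
  exists cAB : composable A B,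
  forall sA sB, reach (sync_comp cAB) (sA, sB) ->
    (forall a, (out A `&` inp B) a ->
       (exists sA', trans sA a sA') -> exists sB', trans sB a sB') /\
    (forall b, (out B `&` inp A) b ->
       (exists sB', trans sB b sB') -> exists sA', trans sA b sA').

Definition weakly_sync_compatible A B : Prop :=
  exists cAB : composable A B,
  forall sA sB, reach (sync_comp cAB) (sA, sB) ->
    (forall a, (out A `&` inp B) a ->
       (exists sA', trans sA a sA') ->
       exists tB sB', steps (int B) sB tB /\ trans tB a sB') /\
    (forall b, (out B `&` inp A) b ->
       (exists sB', trans sB b sB') ->
       exists tA sA', steps (int A) sA tA /\ trans tA b sA').

Definition strongly_async_compatible A B (cAB : async_composable A B) : Prop :=
  strongly_sync_compatible (omega cAB) (omega (async_composable_sym cAB)).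

Definition weakly_async_compatible A B (cAB : async_composable A B) : Prop :=
  weakly_sync_compatible (omega cAB) (omega (async_composable_sym cAB)).

Definition half_duplex A B (cAB : async_composable A B) : Prop :=
  forall sA qA sB qB,
    reach (async_comp cAB) ((sA, qA), (sB, qB)) -> qA = [::] \/ qB = [::].

Definition weak_trans A B (s : states A) (a : N) (s' : states A) : Prop :=
  exists t t', [/\ steps (act A `\` shared A B) s t, trans t a t' &
                   steps (act A `\` shared A B) t' s'].

Fixpoint weak_word A B (s : states A) (w : seq (out_to A B)) (s' : states A)
    : Prop :=
  if w is a :: w' then exists2 t, weak_trans B s (val a) t & weak_word t w' s'
  else s = s'.

Definition property_P A B (cAB : async_composable A B) : Prop :=
  forall sA qA sB qB, reach (async_comp cAB) ((sA, qA), (sB, qB)) ->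
    [\/ [/\ qA = [::], qB = [::] & reach (sync_comp (proj1 cAB)) (sA, sB)],
        [/\ qA <> [::], qB = [::] & exists2 rA,
           reach (sync_comp (proj1 cAB)) (rA, sB) & weak_word rA qA sA] |
        [/\ qA = [::], qB <> [::] & exists2 rB,
           reach (sync_comp (proj1 cAB)) (sA, rB) & weak_word rB qB sB]].

End Iots.

Arguments reach {N} A _.

(* Main.v *)
Require Import Defs.
From mathcomp Require Import all_boot.
From mathcomp Require Import boolp classical_sets.
From Stdlib Require Import Relation_Operators Operators_Properties.
Local Open Scope classical_set_scope.

(** A synchronous communication is simulated asynchronously by an enqueue
    immediately followed by the matching dequeue, so every reachable state of
    [A ⊗ B] is reachable, with empty queues, in the asynchronous composition.
    If moreover [A] can output [a], it can put [a] into its queue, and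
    asynchronous compatibility makes [B] eventually accept [a]. Weakly, [B] may
    first perform internal steps of [Omega(B)], which could include enqueueing.
    Property P implies half-duplex, and half-duplex implies condition (c); by
    (c), [B] cannot enqueue while [A] is ready to output, hence these internal
    steps are internal steps of [B] itself. *)

Section Iots.
Set Implicit Arguments.
Unset Strict Implicit.
Context {N : names}.
Implicit Types A B : iots N.

Lemma reach_step A (s s' : states A) a :
  reach A s -> trans s a s' -> reach A s'.
Proof.
move=> rs ss'; apply/clos_rt_rt1n_iff/(rt_trans _ _ _ s).
  exact/clos_rt_rt1n_iff.
by apply: rt_step; exists a => //; exact: trans_act ss'.
Qed.

(** Invariants need induction on the last step of a run, whereas [steps] splits off the first. *)
Lemma reach_ind A (P : states A -> Prop) :
  P (start A) ->
  (forall s a s', reach A s -> P s -> trans s a s' -> P s') ->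
  forall s, reach A s -> P s.
Proof.
move=> P0 PS s /clos_rt_rt1n_iff/clos_rt_rtn1_iff.
elim=> // s1 s2 [a _ s12] r1 Ps1; apply: PS Ps1 s12.
exact/clos_rt_rt1n_iff/clos_rt_rtn1_iff.
Qed.

Lemma reach_swap A B (c : composable A B) (c' : composable B A) s t :
  reach (sync_comp c) (s, t) -> reach (sync_comp c') (t, s).
Proof.
pose P (p : states (sync_comp c)) := reach (sync_comp c') (p.2, p.1).
rewrite -/(P (s, t)); apply: reach_ind; first exact: rt1n_refl.
move=> p a p' _ Pp tr; case: tr Pp => {p a p'}; rewrite /P /=.
- move=> x a x' y ns xx' /reach_step; apply.
  by apply: sync_right xx'; rewrite shared_sym.
- move=> x y a y' ns yy' /reach_step; apply.
  by apply: sync_left yy'; rewrite shared_sym.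
- move=> x y a x' y' sh xx' yy' /reach_step; apply.
  by apply: sync_shared yy' xx'; rewrite shared_sym.
Qed.

Lemma rhd_not_act A B (cAB : async_composable A B) a :
  out_to A B a -> ~ act A (rhd a) /\ ~ act B (rhd a).
Proof.
by move=> /(rhd_out_to_fresh cAB) fr; split=> x; apply: fr; [left|right].
Qed.

Lemma int_not_shared A B a : int B a -> ~ shared A B a.
Proof.
move=> k [] [x y]; suff: set0 a by [].
- by rewrite -(out_int0 B).
- by rewrite -(inp_int0 B).
Qed.

Lemma inp_not_out_to A B a : inp A a -> ~ out_to A B a.
Proof. by move=> i [o _]; suff: set0 a by []; rewrite -(inp_out0 A). Qed.

(** Being fresh, [rhd a] is not shared, so [omega cAB] moves alone. Keeping [cBA] and [cO]
    arbitrary, here and below, lets [A] and [B] be exchanged freely. *)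
Lemma reach_enqueue A B (cAB : async_composable A B)
    (cBA : async_composable B A) (cO : composable (omega cAB) (omega cBA))
    s q t r (a : out_to A B) s' :
  reach (sync_comp cO) ((s, q), (t, r)) -> trans s (val a) s' ->
  reach (sync_comp cO) ((s', rcons q a), (t, r)).
Proof.
move=> /reach_step h ss'; apply: (h _ (rhd (val a))).
have [nA _] := rhd_not_act cAB (set_mem (valP a)).
apply: sync_left; last exact: omega_enqueue.
by case=> -[x y]; apply: nA; left; [left|right].
Qed.

Lemma reach_transmit A B (cAB : async_composable A B)
    (cBA : async_composable B A) (cO : composable (omega cAB) (omega cBA))
    s t a s' t' :
  out_to A B a -> trans s a s' -> trans t a t' ->
  reach (sync_comp cO) ((s, [::]), (t, [::])) ->
  reach (sync_comp cO) ((s', [::]), (t', [::])).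
Proof.
move=> oa ss' tt' r.
pose a' : out_to A B := SigSub (mem_set oa).
apply: (reach_step (a := a) (reach_enqueue (a := a') r ss')).
apply: (@sync_shared _ (omega cAB) (omega cBA) _ _ a).
- by case: (oa) => o i; right.
- exact: (omega_dequeue s' a').
- by apply: omega_keep => //; apply: inp_not_out_to; case: (oa).
Qed.

Lemma reach_empty_queues A B (c : composable A B) (cAB : async_composable A B)
    (cBA : async_composable B A) (cO : composable (omega cAB) (omega cBA)) s t :
  reach (sync_comp c) (s, t) ->
  reach (sync_comp cO) ((s, [::]), (t, [::])).
Proof.
pose P (p : states (sync_comp c)) :=
  reach (sync_comp cO) ((p.1, [::]), (p.2, [::])).
rewrite -/(P (s, t)); apply: reach_ind; first exact: rt1n_refl.
move=> p a p' _ Pp tr; case: tr Pp => {p a p'}; rewrite /P /=.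
- move=> x a x' y ns xx' /reach_step; apply.
  apply: (@sync_left _ (omega cAB) (omega cBA)); first exact: ns.
  by apply: omega_keep => // -[o i]; apply: ns; right.
- move=> x y a y' ns yy' /reach_step; apply.
  apply: (@sync_right _ (omega cAB) (omega cBA)); first exact: ns.
  by apply: omega_keep => // -[o i]; apply: ns; left.
- move=> x y a x' y' [[i o]|[i o]] xx' yy' r; last exact: reach_transmit xx' yy' r.
  (* Here [B] is the sender, so the transmission takes place in the swapped composition. *)
  apply: (reach_swap (c := composable_sym cO)).
  by apply: reach_transmit yy' xx' (reach_swap _ r).
Qed.

(** An input of [B] is neither a fresh name, which excludes enqueueing, nor an output of [B], which
    excludes dequeueing. *)
Lemma omega_receive A B (cBA : async_composable B A) a t r p :
  out_to A B a -> @omega_trans N B A (t, r) a p -> exists t', trans t a t'.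
Proof.
case=> o i tr; move: (inp_not_out_to (B := A) i) => no.
inversion tr as [? ? ? s' _ ss'|? ? b s' ss' e1 e2|? b q e1 e2]; subst.
- by exists s'.
- have [nB _] := rhd_not_act cBA (set_mem (valP b)).
  by case: nB; left; left.
- by case: no; exact: set_mem (valP b).
Qed.

(** This is condition (c). *)
Definition output_conflict_free A B (c : composable A B) : Prop :=
  forall sA sB, reach (sync_comp c) (sA, sB) ->
  forall a b sA' sB', trans sA a sA' -> trans sB b sB' ->
  ~ out_to A B a \/ ~ out_to B A b.

Lemma output_conflict_free_sym A B (c : composable A B) (c' : composable B A) :
  output_conflict_free c -> output_conflict_free c'.
Proof.
move=> h sB sA r b a sB' sA' tb ta.
by case: (h _ _ (reach_swap c r) _ _ _ _ ta tb); [right|left].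
Qed.

Lemma property_P_half_duplex A B (cAB : async_composable A B) :
  property_P cAB -> half_duplex cAB.
Proof. by move=> P sA qA sB qB /P[] []; [left|right|left]. Qed.

(** Two conflicting outputs could both be enqueued, starting from empty queues, leaving both queues
    nonempty. *)
Lemma half_duplex_output_conflict_free A B (cAB : async_composable A B) :
  half_duplex cAB -> output_conflict_free (proj1 cAB).
Proof.
move=> hd sA sB r a b sA' sB' ta tb; apply/not_andP => -[oa ob].
pose a' : out_to A B := SigSub (mem_set oa).
pose b' : out_to B A := SigSub (mem_set ob).
have cO := omega_composable cAB.
have r0 := reach_empty_queues cO r.
have r1 := reach_enqueue (a := a') r0 ta.
have r2 := reach_swap (composable_sym cO) r1.
have r3 := reach_enqueue (a := b') r2 tb.
by case: (hd _ _ _ _ (reach_swap (omega_composable cAB) r3)).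
Qed.

(* As long as [A] is ready to output, condition (c) keeps [B] from enqueueing. *)
Lemma omega_int_steps A B (c : composable A B) (cBA : async_composable B A)
    a sA sA' sB p :
  output_conflict_free c -> out_to A B a -> trans sA a sA' ->
  reach (sync_comp c) (sA, sB) ->
  @steps N (omega cBA) (int (omega cBA)) (sB, [::]) p ->
  steps (int B) sB p.1.
Proof.
move=> cf oa ta r st; move E : (sB, [::]) st => p0 st.
elim: st sB r E => {p0 p} [p|p p1 p2 [x kx tr] _ IH] sB r E; subst.
  exact: rt1n_refl.
inversion tr as [? ? ? s' no ss'|? ? b s' ss' e1 e2|? b q e1 e2]; subst.
(* A fresh name labels no transition of [B]. *)
- have kB : int B x.
    case: kx => // -[b ob e]; subst x.
    have [[]] := rhd_not_act cBA ob; exact: trans_act ss'.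
  (* [A] stays in [sA], still ready to output [a], so the induction hypothesis applies. *)
  have r' : reach (sync_comp c) (sA, s').
    by apply: (reach_step r); apply: sync_right ss'; exact: int_not_shared.
  have st := IH _ r' erefl.
  by apply: Relation_Operators.rt1n_trans st; exists x.
- by case: (cf _ _ r _ _ _ _ ta ss') => []; last by case; exact: set_mem (valP b).
Qed.

Lemma strong_receive A B (c : composable A B) (cAB : async_composable A B)
    (cBA : async_composable B A) (cO : composable (omega cAB) (omega cBA)) :
  (forall p q, reach (sync_comp cO) (p, q) ->
     forall a, out_to A B a -> (exists p', @trans N (omega cAB) p a p') ->
     exists q', @trans N (omega cBA) q a q') ->
  forall sA sB, reach (sync_comp c) (sA, sB) ->
  forall a, out_to A B a -> (exists sA', trans sA a sA') ->
  exists sB', trans sB a sB'.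
Proof.
move=> h sA sB r a oa [sA' ta].
pose a' : out_to A B := SigSub (mem_set oa).
have r0 := reach_empty_queues cO r.
have /h/(_ a oa) := reach_enqueue (a := a') r0 ta.
(* In [omega cAB] the label [a] belongs to the dequeue, hence the preceding enqueue. *)
case; first by exists (sA', [::]); exact: (omega_dequeue sA' a').
by move=> q'; exact: omega_receive.
Qed.

Lemma weak_receive A B (c : composable A B) (cAB : async_composable A B)
    (cBA : async_composable B A) (cO : composable (omega cAB) (omega cBA)) :
  output_conflict_free c ->
  (forall p q, reach (sync_comp cO) (p, q) ->
     forall a, out_to A B a -> (exists p', @trans N (omega cAB) p a p') ->
     exists u q', @steps N (omega cBA) (int (omega cBA)) q u /\
                  @trans N (omega cBA) u a q') ->
  forall sA sB, reach (sync_comp c) (sA, sB) ->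
  forall a, out_to A B a -> (exists sA', trans sA a sA') ->
  exists tB sB', steps (int B) sB tB /\ trans tB a sB'.
Proof.
move=> cf h sA sB r a oa [sA' ta].
pose a' : out_to A B := SigSub (mem_set oa).
have r0 := reach_empty_queues cO r.
have /h/(_ a oa) := reach_enqueue (a := a') r0 ta.
case; first by exists (sA', [::]); exact: (omega_dequeue sA' a').
move=> [tB q] [q' [st tr]].
(* Condition (c) is used at [sA], before the output: [(sA', sB)] need not be reachable in
   [A ⊗ B]. *)
have stB := omega_int_steps cf oa ta r st.
have [sB' ts] := omega_receive cBA oa tr.
by exists tB, sB'.
Qed.

End Iots.

Theorem theorem4p9 (N : names) (A B : iots N) (cAB : async_composable A B) :
  (strongly_async_compatible cAB -> strongly_sync_compatible A B)
  /\
  ([\/ property_P cAB,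
       half_duplex cAB |
       forall (sA : states A) (sB : states B),
         reach (sync_comp (proj1 cAB)) (sA, sB) ->
         forall (a b : N) (sA' : states A) (sB' : states B),
           trans sA a sA' -> trans sB b sB' ->
           ~ (out A `&` inp B) a \/ ~ (out B `&` inp A) b] ->
   weakly_async_compatible cAB -> weakly_sync_compatible A B).
Proof.
have c := proj1 cAB; have c' := composable_sym c.
split=> [[cO h]|cond [cO h]]; have cO' := composable_sym cO.
  exists c => sA sB r; split.
    by apply: (strong_receive (c := c) (cO := cO)) r => p q /h[].
  apply: (strong_receive (c := c') (cO := cO')) (reach_swap c' r) => q p.
  by move=> /(reach_swap cO)/h[].
have cf : output_conflict_free (proj1 cAB).
  case: cond => [/property_P_half_duplex|| //];
    exact: half_duplex_output_conflict_free.
exists (proj1 cAB) => sA sB r; split.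
  by apply: (weak_receive (cO := cO) cf) r => p q /h[].
apply: (weak_receive (c := c') (cO := cO')) (reach_swap c' r).
  exact: output_conflict_free_sym cf.
by move=> q p /(reach_swap cO)/h[].
Qed.
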